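(* Let $q=2^m$ with $m>1$, let $d$ be an odd positive integer and let $\gamma\in\mathbb{F}_{q^d}$. Then the polynomial $$f(x)=x+\gamma\,\mathrm{Tr}_q^{q^d}\!\left(x^{q+1}+x^{2q+2}\right)$$ is a permutation polynomial of $\mathbb{F}_{q^d}$ if and only if $\gamma\in\mathbb{F}_q$ and the equation $\gamma t^3+\gamma t+1=0$ has no solution $t\in\mathbb{F}_q$.
   Context: A polynomial over a finite field $\mathbb{F}$ is a permutation polynomial of $\mathbb{F}$ if the map it induces on $\mathbb{F}$ is a bijection. For $x\in\mathbb{F}_{q^d}$, $\mathrm{Tr}_q^{q^d}(x)=x+x^q+\cdots+x^{q^{d-1}}$. *)

(* Defs.v *)
From HB Require Import structures.
From mathcomp Require Import all_boot all_order all_algebra all_field.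

Set Implicit Arguments.
Unset Strict Implicit.
Unset Printing Implicit Defensive.

Import GRing.Theory.
Local Open Scope ring_scope.

Definition permutation_poly (F : fieldType) (p : {poly F}) : Prop :=
  bijective (fun x : F => p.[x]).

(* Tr_q^{q^d}, over an arbitrary ring so that it applies both to elements of *)
(* F_{q^d} and, as in the polynomial f below, to polynomials over it.        *)
Definition Tr (R : nzRingType) (q d : nat) (x : R) : R :=
  \sum_(i < d) x ^+ (q ^ i)%N.

Definition f_poly (F : fieldType) (q d : nat) (gamma : F) : {poly F} :=
  'X + gamma *: Tr q d ('X^(q + 1) + 'X^(2 * q + 2)).

(* Main.v *)
(** The trace term takes values in F_q, so f(x) = f(y) forces y = x + gamma a
    with a in F_q.  Put Q(x) = Tr(x^(q+1)), a quadratic form over F_q; the trace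
    term is Q + Q^2.  Since Q(x + gamma a) = Q(x) + a B(x) + a^2 Q(gamma) with
    B(x) = Tr(x^q (gamma^(q^2) + gamma)), a collision is a nonzero a in F_q with
    a = u + u^2, where u = a B(x) + a^2 Q(gamma).  If gamma lies in F_q then B = 0
    and Q(gamma) = gamma^2, so that t = gamma a solves the cubic.  Otherwise
    gamma^(q^2) <> gamma because d is odd, so B is onto F_q: any u in F_q outside
    {0, 1} gives a collision. *)
Require Import Defs.
From HB Require Import structures.
From mathcomp Require Import all_boot all_order all_algebra all_field.
From mathcomp Require Import ring.

Set Implicit Arguments.
Unset Strict Implicit.
Unset Printing Implicit Defensive.

Import GRing.Theory.
Local Open Scope ring_scope.

(** [V] is finite through its copy [finvect_type V], so counting applies to [g]. *)
Lemma finvect_inj_bij (F : finFieldType) (V : vectType F) (g : V -> V) :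
  injective g -> bijective g.
Proof. exact: (@injF_bij (finvect_type V)). Qed.

(** * Frobenius and trace of a finite extension of [F] *)

Section Trace.

Variables (F : finFieldType) (L : fieldExtType F).
Implicit Types (x y c : L).
Local Notation q := #|F|.
Local Notation d := (\dim {:L}).

Lemma exprD_card x y i : (x + y) ^+ (q ^ i)%N = x ^+ (q ^ i)%N + y ^+ (q ^ i)%N.
Proof.
apply: exprDn_pchar; have [p p_pr charFp] := finPcharP F.
rewrite (eq_pnat _ (pcharf_eq (_ : p \in [pchar L]))) ?pchar_lalg //.
rewrite pnatX; apply/orP; left.
(* The additive group of [F] is a p-group, so [q] is a power of the characteristic. *)
by have := pprimeChar_pgroup charFp; rewrite /pgroup.pgroup cardsT.
Qed.

Lemma expr_card_dim x : x ^+ (q ^ d)%N = x.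
Proof. by apply/eqP; rewrite -Fermat's_little_theorem memvf. Qed.

Lemma mem1v_expr x : (x \in 1%VS) = (x ^+ q == x).
Proof. by rewrite (Fermat's_little_theorem 1%AS) dimv1 expn1. Qed.

Lemma mem1v_exprX c i : c \in 1%VS -> c ^+ (q ^ i)%N = c.
Proof.
by rewrite mem1v_expr => /eqP cq; elim: i => // i IHi; rewrite expnS exprM cq.
Qed.

(** The d-th iterate of Frobenius is the identity, so its (d-1)-th iterate inverts it. *)
Lemma expr_card_root x : exists y, y ^+ q = x.
Proof.
exists (x ^+ (q ^ d.-1)%N).
by rewrite -exprM -expnSr prednK ?adim_gt0 ?expr_card_dim.
Qed.

Lemma TrD x y : Tr q d (x + y) = Tr q d x + Tr q d y.
Proof. by rewrite /Tr -big_split; apply: eq_bigr => i _; rewrite exprD_card. Qed.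

Lemma TrZ c x : c \in 1%VS -> Tr q d (c * x) = c * Tr q d x.
Proof.
by move=> cF; rewrite mulr_sumr; apply: eq_bigr => i _; rewrite exprMn mem1v_exprX.
Qed.

Lemma Tr_mem1 c : c \in 1%VS -> Tr q d c = c *+ d.
Proof.
move=> cF; rewrite -[d in RHS]card_ord -sumr_const.
by apply: eq_bigr => i _; rewrite mem1v_exprX.
Qed.

Lemma Tr_expr x : Tr q d (x ^+ q) = Tr q d x.
Proof.
rewrite /Tr; have := expr_card_dim x; have := adim_gt0 {:L}%AS.
(* Frobenius rotates the summands: the last one becomes x^(q^d) = x, the first term of the other
   sum. *)
case: (\dim _) => // n _ xqd; rewrite big_ord_recr [RHS]big_ord_recl /= addrC.
rewrite expn0 expr1 -exprM -expnS xqd; congr (_ + _).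
by apply: eq_bigr => i _; rewrite -exprM -expnS.
Qed.

Lemma Tr_mem x : Tr q d x \in 1%VS.
Proof.
rewrite mem1v_expr -{2}Tr_expr; apply/eqP; rewrite /Tr.
have E y z : (y + z) ^+ q = y ^+ q + z ^+ q by have := exprD_card y z 1.
rewrite (big_morph (fun z : L => z ^+ q) E (id1 := 0)).
  by apply: eq_bigr => i _; rewrite -!exprM mulnC.
by apply/eqP; rewrite -mem1v_expr rpred0.
Qed.

(* As a polynomial the trace has degree q^(d-1), less than the number of points. *)
Lemma Tr_neq0 : exists x, Tr q d x != 0.
Proof.
pose V := finvect_type L.
pose P : {poly L} := Tr q d 'X.
have q1 : (1 < q)%N by exact: finNzRing_gt1.
have PE x : P.[x] = Tr q d x.
  by rewrite horner_sum; apply: eq_bigr => i _; rewrite hornerXn.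
have sP : size P = (q ^ d.-1).+1.
  rewrite /P /Tr; have := adim_gt0 {:L}%AS; case: (\dim _) => // n _.
  rewrite big_ord_recr /= addrC size_polyDl size_polyXn //.
  apply: leq_ltn_trans (size_sum _ _ _) _; rewrite ltnS.
  by apply/bigmax_leqP => i _; rewrite size_polyXn ltn_exp2l.
have [/existsP[x xP]|] := boolP [exists x : V, Tr q d (x : L) != 0].
  by exists x.
rewrite negb_exists => /forallP P0.
have P_neq0 : P != 0 by rewrite -size_poly_eq0 sP.
have uniqV : uniq (enum V : seq L) := enum_uniq V.
have sV : size (enum V : seq L) = (q ^ d)%N.
  transitivity #|V|; first exact/esym/cardE.
  by rewrite -(card_vspacef (Vector.class V)) card_vspace.
have rootV : all (root P) (enum V : seq L).
  by apply/allP => x _; rewrite /root PE; have := P0 x; rewrite negbK.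
have := max_poly_roots P_neq0 rootV uniqV.
rewrite sV sP ltnS leq_exp2l // -[X in (X <= _)%N]prednK ?adim_gt0 //.
by rewrite ltnn.
Qed.

Lemma Tr_surj c : c \in 1%VS -> exists x, Tr q d x = c.
Proof.
move=> cF; have [x xP] := Tr_neq0; exists (c / Tr q d x * x).
by rewrite TrZ ?divfK // rpred_div // Tr_mem.
Qed.

(** Writing d = 2k + 1, the d-th iterate of Frobenius fixes [x], and so does the 2k-th; hence
    Frobenius itself does. *)
Lemma odd_dim_expr x : odd d -> x ^+ (q ^ 2)%N = x -> x \in 1%VS.
Proof.
move=> d_odd xq2; rewrite mem1v_expr.
have xq2k k : x ^+ (q ^ (2 * k))%N = x.
  by elim: k => // k IHk; rewrite mulnS expnD exprM xq2.
have := expr_card_dim x.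
rewrite -[d]odd_double_half d_odd -mul2n addnC expnD exprM xq2k expn1.
by move=> ->.
Qed.

End Trace.

(** * The quadratic form [Q] and collisions of f in characteristic 2 *)

Section CharacteristicTwo.

Variables (m : nat) (F : finFieldType) (L : fieldExtType F).
Hypotheses (cardF : #|F| = (2 ^ m)%N) (d_odd : odd (\dim {:L})).
Implicit Types (x y a c gamma : L).
Local Notation q := #|F|.
Local Notation d := (\dim {:L}).

Let Q x : L := Tr q d (x ^+ (q + 1)).

Lemma pchar2 : 2 \in [pchar L].
Proof. by rewrite pchar_lalg (card_finPcharP cardF). Qed.

Let addxx x : x + x = 0 := addrr_pchar2 pchar2 x.

Lemma eq_pchar2 x y : x + y = 0 -> x = y.
Proof. by move/eqP; rewrite addr_eq0 (oppr_pchar2 pchar2) => /eqP. Qed.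

Lemma sqrrD_pchar2 x y : (x + y) ^+ 2 = x ^+ 2 + y ^+ 2.
Proof. by apply: exprDn_pchar; rewrite pnatE // pchar2. Qed.

Lemma Tr_sqr x : Tr q d (x ^+ 2) = Tr q d x ^+ 2.
Proof.
rewrite /Tr (big_morph (fun z : L => z ^+ 2) sqrrD_pchar2 (id1 := 0)) ?expr0n //.
by apply: eq_bigr => i _; rewrite -!exprM mulnC.
Qed.

(** The odd number [d] equals 1 in characteristic 2, which makes the trace the identity on F_q. *)
Lemma odd_mulrn x : x *+ d = x.
Proof.
by rewrite -[d]odd_double_half d_odd mulrnDr -muln2 mulnC mulrnA mulr2n addxx mul0rn addr0.
Qed.

Lemma f_polyE gamma x : (f_poly q d gamma).[x] = x + gamma * (Q x + Q x ^+ 2).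
Proof.
rewrite /f_poly hornerD hornerX hornerZ horner_sum -Tr_sqr -TrD -exprM mulnDl.
rewrite mul1n [(q * 2)%N]mulnC; congr (_ + _ * _); apply: eq_bigr => i _.
by rewrite horner_exp hornerD !hornerXn.
Qed.

Lemma Q_add gamma a x : a \in 1%VS ->
  Q (x + gamma * a) =
  Q x + (a * Tr q d (x ^+ q * (gamma ^+ (q ^ 2)%N + gamma)) + a ^+ 2 * Q gamma).
Proof.
rewrite /Q => aF; have aq : a ^+ q = a by apply/eqP; rewrite -mem1v_expr.
have -> : (x + gamma * a) ^+ (q + 1) = x ^+ (q + 1)
    + (a * (x ^+ q * gamma + gamma ^+ q * x) + a ^+ 2 * gamma ^+ (q + 1)).
  have := exprD_card x (gamma * a) 1; rewrite expn1 => E.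
  rewrite !exprD !expr1 E exprMn aq; ring.
rewrite 2!TrD (TrZ _ aF) (TrZ _ (rpredX 2 aF)); congr (_ + (_ * _ + _)).
rewrite [in RHS]mulrDr !TrD.
(* Applying Frobenius under the trace turns gamma^q x into gamma^(q^2) x^q, so both cross terms
   share the factor x^q. *)
rewrite -(Tr_expr (gamma ^+ q * x)) exprMn -exprM.
by rewrite addrC [_ ^+ (_ * _) * _]mulrC.
Qed.

Lemma Q_mem1 c : c \in 1%VS -> Q c = c ^+ 2.
Proof.
move=> cF; rewrite /Q Tr_mem1 ?rpredX // odd_mulrn exprD expr1.
by have := cF; rewrite mem1v_expr => /eqP ->.
Qed.

Lemma Q_mem x : Q x \in 1%VS.
Proof. exact: Tr_mem. Qed.

Lemma f_poly_inj_mem1 gamma : (2 < q)%N ->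
  injective (horner (f_poly q d gamma)) -> gamma \in 1%VS.
Proof.
move=> q_gt2 f_inj; apply/negPn/negP => gammaF.
have del0 : gamma ^+ (q ^ 2)%N + gamma != 0.
  by apply: contra gammaF => /eqP/eq_pchar2/(odd_dim_expr d_odd).
set del := _ + _ in del0.
have [u uF /andP[u0 u1]] : exists2 u : L, u \in 1%VS & (u != 0) && (u != 1).
  have /card_gt0P[c] : (0 < #|predC (pred2 (0%R : F) 1%R)|)%N.
    move: q_gt2; rewrite -(cardC (pred2 (0%R : F) 1%R)) card2 eq_sym oner_eq0.
    by rewrite -[X in (X < _)%N]addn0 ltn_add2l.
  rewrite !inE negb_or => /andP[c0 c1].
  exists c%:A; first by rewrite rpredZ // rpred1.
  rewrite -in_algE fmorph_eq0 c0 -(rmorph1 (in_alg L)).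
  by rewrite (inj_eq (fmorph_inj _)).
pose a := u + u ^+ 2.
have aF : a \in 1%VS by rewrite rpredD // rpredX.
have a0 : a != 0.
  have -> : a = u * (1 + u) by rewrite mulrDr mulr1.
  by rewrite mulf_neq0 //; apply: contra u1 => /eqP/eq_pchar2 <-.
(* This trace value makes the increment a Tr(z) + a^2 Q(gamma) equal to [u]; then [x] is chosen with
   x^q [del] = z. *)
have [|z zP] := @Tr_surj F L ((u + a ^+ 2 * Q gamma) / a).
  by rewrite rpred_div // rpredD // rpredM ?rpredX ?Q_mem.
have [x xq] := expr_card_root (z / del).
have E : Q (x + gamma * a) = Q x + u.
  by rewrite Q_add // xq divfK // zP [a * _]mulrC divfK // -addrA addxx addr0.
(* The value of f changes by gamma (a + u + u^2), which is 0 by the choice of [a]. *)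
have : x + gamma * a = x.
  apply: f_inj; rewrite !f_polyE E sqrrD_pchar2 /a.
  set v := u ^+ 2; set w := Q x ^+ 2.
  transitivity (x + gamma * (Q x + w) + gamma * ((u + u) + (v + v))); first by ring.
  by rewrite !addxx !(addr0, mulr0).
move/eqP; rewrite -subr_eq0 addrAC subrr add0r mulf_eq0 (negbTE a0) orbF.
by move/eqP => g0; rewrite g0 rpred0 in gammaF.
Qed.

(** On F_q, f(t) = t + gamma (t^2 + t^4) is t times the cubic. A root thus collides with 0, yet 0 is
    not a root. *)
Lemma f_poly_inj_cubic gamma t : gamma \in 1%VS ->
  injective (horner (f_poly q d gamma)) ->
  t \in 1%VS -> gamma * t ^+ 3 + gamma * t + 1 != 0.
Proof.
move=> gammaF f_inj tF; apply/eqP => t_root.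
have t0 : t = 0.
  apply: f_inj; rewrite !f_polyE !Q_mem1 ?rpred0 //.
  transitivity (t * (gamma * t ^+ 3 + gamma * t + 1)); first by ring.
  by rewrite t_root; ring.
by move/eqP: t_root; rewrite t0 expr0n /= !mulr0 !add0r oner_eq0.
Qed.

Lemma f_poly_inj gamma : gamma \in 1%VS ->
  (forall t, t \in 1%VS -> gamma * t ^+ 3 + gamma * t + 1 != 0) ->
  injective (horner (f_poly q d gamma)).
Proof.
move=> gammaF no_root x y; rewrite !f_polyE => fxy.
pose g z := Q z + Q z ^+ 2.
have gF z : g z \in 1%VS by rewrite rpredD ?rpredX ?Q_mem.
pose a := g x + g y.
have aF : a \in 1%VS by rewrite rpredD.
have yE : y = x + gamma * a.
  apply: eq_pchar2; rewrite mulrDr addrA addrA [y + x]addrC.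
  have -> : x + y + gamma * g x + gamma * g y =
            (x + gamma * g x) + (y + gamma * g y) by ring.
  by rewrite fxy addxx.
(* The linear term of [Q_add] vanishes because gamma^(q^2) = gamma. *)
have Qy : Q y = Q x + (gamma * a) ^+ 2.
  rewrite yE Q_add // mem1v_exprX // addxx mulr0 (Q_mem1 gammaF) exprMn [_ * a ^+ 2]mulrC.
  by rewrite /Tr big1 ?mulr0 ?add0r // => i _; rewrite mem1v_exprX ?rpred0.
have aE : a + ((gamma * a) ^+ 2 + (gamma * a) ^+ 4) = 0.
  rewrite {1}/a /g Qy sqrrD_pchar2; move: (gamma * a) (Q x) => b w.
  transitivity ((w + w) + (w ^+ 2 + w ^+ 2) + (b ^+ 2 + b ^+ 2) + (b ^+ 4 + b ^+ 4)).
    by ring.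
  by rewrite !(addxx, addr0).
(* Factoring out [a] leaves the cubic at t = gamma a, which is nonzero by hypothesis, so a = 0. *)
have : a * (gamma * (gamma * a) ^+ 3 + gamma * (gamma * a) + 1) = 0.
  by rewrite -aE; ring.
move/eqP; rewrite mulf_eq0 (negbTE (no_root _ _)) ?rpredM // orbF => /eqP a0.
by rewrite yE a0 mulr0 addr0.
Qed.

End CharacteristicTwo.

Theorem theorem4p1 (m q d : nat) (hm : (1 < m)%N) (hq : q = (2 ^ m)%N)
    (hd : odd d) (Fq : finFieldType) (hFq : #|Fq| = q)
    (L : fieldExtType Fq) (hL : \dim {:L} = d) (gamma : L) :
  permutation_poly (f_poly q d gamma) <->
  gamma \in 1%VS /\
  ~ (exists2 t : L, t \in 1%VS & gamma * t ^+ 3 + gamma * t + 1 = 0).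
Proof.
have cardF : #|Fq| = (2 ^ m)%N by rewrite hFq.
have q_gt2 : (2 < #|Fq|)%N by rewrite cardF -[2%N]/(2 ^ 1)%N ltn_exp2l.
rewrite -hFq -hL in hd *; split.
  move=> /bij_inj f_inj; have gammaF := f_poly_inj_mem1 cardF hd q_gt2 f_inj.
  split=> // -[t tF /eqP]; apply/negP.
  exact: (f_poly_inj_cubic cardF hd gammaF f_inj).
case=> gammaF no_root; apply: finvect_inj_bij.
apply: (f_poly_inj cardF hd gammaF) => t tF.
by apply/eqP => t_root; apply: no_root; exists t.
Qed.
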